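(* Having finite packing is a quasi-isometry invariant of group pairs: if $(G,\mathcal{P})$ and $(H,\mathcal{Q})$ are quasi-isometric group pairs, then $(G,\mathcal{P})$ has finite packing if and only if $(H,\mathcal{Q})$ has finite packing.
   Context: A group pair $(G,\mathcal{P})$ is a finitely generated group $G$ together with a finite collection $\mathcal{P}$ of infinite subgroups of $G$. $G$ carries a fixed word metric with respect to a finite generating set and $\mathrm{hdist}_G$ is the corresponding Hausdorff distance between subsets. $G/\mathcal{P}$ is the set of all left cosets $gP$, $g\in G$, $P\in\mathcal{P}$. $(G,\mathcal{P})$ and $(H,\mathcal{Q})$ are quasi-isometric if there are a quasi-isometry $q\colon G\to H$ and $M>0$ such that for every $A\in G/\mathcal{P}$ there is $B\in H/\mathcal{Q}$ with $\mathrm{hdist}_H(q(A),B)<M$, and for every $B\in H/\mathcal{Q}$ there is $A\in G/\mathcal{P}$ with $\mathrm{hdist}_H(q(A),B)<M$. $(G,\mathcal{P})$ has finite packing if there is a finite subset $D\subset G/\mathcal{P}$ such that for any finite subset $\{g_1P_1,\dots,g_dP_d\}$ of $G/\mathcal{P}$ with $\bigcap_{i=1}^d g_iP_ig_i^{-1}$ infinite, there is $g\in G$ such that $gg_iP_i\in D$ for each $i\in\{1,\dots,d\}$. *)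

(* Defs.v *)
From mathcomp Require Import all_boot all_order all_algebra.
From mathcomp Require Import all_classical all_reals ereal.

Set Implicit Arguments.
Unset Strict Implicit.
Unset Printing Implicit Defensive.

Import Order.TTheory GRing.Theory Num.Theory.

Local Open Scope classical_set_scope.
Local Open Scope ring_scope.

Definition is_subgroup (G : groupType) (H : set G) : Prop := group_closed [in H].

Definition generates (G : groupType) (S : set G) : Prop :=
  smallest (@is_subgroup G) S = [set: G].

Definition finitely_generated (G : groupType) : Prop :=
  exists S : set G, finite_set S /\ generates S.

Definition lcoset (G : groupType) (g : G) (H : set G) : set G :=
  [set (g * h)%g | h in H].

(* g H g^-1; the library's conjg x y is y^-1 x y instead *)
Definition lconj (G : groupType) (g : G) (H : set G) : set G :=
  [set (g * h * g^-1)%g | h in H].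

Definition left_cosets (G : groupType) (P : set (set G)) : set (set G) :=
  [set A | exists g : G, exists2 H : set G, P H & A = lcoset g H].

Record group_pair (G : groupType) (P : set (set G)) : Prop := GroupPair {
  gp_fg : finitely_generated G;
  gp_finite : finite_set P;
  gp_subgroup : forall H, P H -> is_subgroup H;
  gp_infinite : forall H, P H -> infinite_set H
}.

Definition is_word (G : groupType) (S : set G) (s : seq G) : Prop :=
  forall x, x \in s -> S x \/ S x^-1%g.

(* The infimum is over a nonempty set, hence a minimum, when S generates G. *)
Definition word_length (R : realType) (G : groupType) (S : set G) (g : G) : R :=
  inf [set (size s)%:R | s in
         [set s : seq G | is_word S s /\ g = (\prod_(x <- s) x)%g]].

Definition word_dist (R : realType) (G : groupType) (S : set G) (g h : G) : R :=
  word_length R S (g^-1 * h)%g.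

Definition thickening (R : realType) (X : Type) (d : X -> X -> R) (r : R)
    (A : set X) : set X :=
  [set x | exists2 a, A a & d x a <= r].

(* +oo when neither set lies in a bounded thickening of the other *)
Definition hdist (R : realType) (X : Type) (d : X -> X -> R) (A B : set X) :
    \bar R :=
  ereal_inf [set r%:E | r in
    [set r : R | 0 <= r /\ A `<=` thickening d r B /\ B `<=` thickening d r A]].

Definition quasi_isometry (R : realType) (X Y : Type)
    (dX : X -> X -> R) (dY : Y -> Y -> R) (q : X -> Y) : Prop :=
  exists K C : R, [/\ 1 <= K, 0 <= C,
    forall x x', K^-1 * dX x x' - C <= dY (q x) (q x') <= K * dX x x' + C
    & forall y, exists x, dY y (q x) <= C].

Definition quasi_isometric_pairs (R : realType) (G H : groupType)
    (S : set G) (T : set H) (P : set (set G)) (Q : set (set H)) : Prop :=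
  exists q : G -> H, exists M : R,
    [/\ quasi_isometry (word_dist R S) (word_dist R T) q, 0 < M,
      forall A, left_cosets P A -> exists2 B, left_cosets Q B &
        (hdist (word_dist R T) (q @` A) B < M%:E)%E
      & forall B, left_cosets Q B -> exists2 A, left_cosets P A &
        (hdist (word_dist R T) (q @` A) B < M%:E)%E].

Definition finite_packing (G : groupType) (P : set (set G)) : Prop :=
  exists D : set (set G), [/\ finite_set D, D `<=` left_cosets P &
    forall (d : nat) (g : 'I_d -> G) (H : 'I_d -> set G),
      (forall i, P (H i)) ->
      infinite_set (\bigcap_(i in [set: 'I_d]) lconj (g i) (H i)) ->
      exists k : G, forall i, D (lcoset (k * g i)%g (H i))].

(* Main.v *)
(* An intersection of conjugates g_i P_i g_i^-1 is infinite iff some uniform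
   thickenings of the cosets g_i P_i have infinite intersection, a coarse
   condition. Finite packing then says that the cosets of any such family all
   meet one ball of uniform radius, because balls are finite and so meet only
   finitely many cosets. Both conditions are transported along the relation
   "y is near q x" between G and H; since the properties of this relation that
   are used are symmetric in G and H, one transfer lemma gives both directions
   without constructing a quasi-inverse of q. *)
Require Import Defs.
From mathcomp Require Import all_boot all_order all_algebra.
From mathcomp Require Import all_classical all_reals ereal.

Set Implicit Arguments.
Unset Strict Implicit.
Unset Printing Implicit Defensive.

Import Order.TTheory GRing.Theory Num.Theory.

Local Open Scope classical_set_scope.
Local Open Scope ring_scope.

(** * Finiteness tools and words in the generators *)

Lemma finite_set_ubound (R : realType) (X : Type) (A : set X) (f : X -> R) :
  finite_set A -> exists r, forall x, A x -> f x <= r.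
Proof.
move=> /(finite_image f)/finite_seqP[s fAs].
have [r rP] : exists r : R, forall y, y \in s -> y <= r.
  elim: s {fAs} => [|y s [r rP]]; first by exists 0.
  exists (Num.max y r) => z; rewrite inE le_max => /predU1P[->|/rP ->].
    by rewrite lexx.
  by rewrite orbT.
exists r => x Ax; apply: rP.
by have : (f @` A) (f x) by [exists x]; rewrite fAs.
Qed.

Lemma finite_set_fibers (X Y : Type) (A : set X) (B : set Y) (F : Y -> set X) :
  finite_set B -> (forall y, B y -> finite_set (F y)) ->
  (forall x, A x -> exists2 y, B y & F y x) -> finite_set A.
Proof.
move=> fB fF AF; apply: sub_finite_set (bigcup_finite fB fF).
by move=> x /AF[y By Fyx]; exists y.
Qed.

Lemma is_word_cat (G : groupType) (S : set G) (s t : seq G) :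
  is_word S s -> is_word S t -> is_word S (s ++ t).
Proof. by move=> Ss St x; rewrite mem_cat => /orP[/Ss|/St]. Qed.

Lemma is_word_inv (G : groupType) (S : set G) (s : seq G) :
  is_word S s -> is_word S (rev [seq x^-1%g | x <- s]).
Proof.
move=> Ss x; rewrite mem_rev => /mapP[y /Ss Sy ->].
by rewrite invgK; case: Sy; [right|left].
Qed.

Lemma prodg_inv (G : groupType) (s : seq G) :
  (\prod_(x <- rev [seq x^-1 | x <- s]) x = (\prod_(x <- s) x)^-1)%g.
Proof.
elim: s => [|x s IHs]; first by rewrite !big_nil invg1.
by rewrite /= rev_cons big_rcons /= IHs big_cons invgM.
Qed.

(** * The word metric and its finite balls *)

Section WordMetric.
Variables (R : realType) (G : groupType) (S : set G).

(** The elements spelled by words form a subgroup containing [S], so they contain the smallest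
    one. *)
Lemma word_exists (g : G) : generates S ->
  exists s, is_word S s /\ g = (\prod_(x <- s) x)%g.
Proof.
move=> genS.
pose W := [set g : G | exists s, is_word S s /\ g = (\prod_(x <- s) x)%g].
suff : smallest (@is_subgroup G) S `<=` W by apply; rewrite genS.
apply: smallest_sub => [|x Sx]; last first.
  exists [:: x]; split; last by rewrite big_seq1.
  by move=> y; rewrite inE => /eqP ->; left.
split=> [|x y]; first by rewrite inE; exists [::]; rewrite big_nil.
rewrite !inE => -[s [Ss ->]] [t [St ->]].
exists (s ++ rev [seq z^-1%g | z <- t]); split; last by rewrite big_cat prodg_inv.
exact: is_word_cat Ss (is_word_inv St).
Qed.

Lemma word_length_le (s : seq G) :
  is_word S s -> word_length R S (\prod_(x <- s) x)%g <= (size s)%:R.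
Proof.
move=> Ss; apply: ge_inf; last by exists s.
by exists 0 => _ [t _ <-]; rewrite ler0n.
Qed.

Lemma word_distxx_le0 (g : G) : word_dist R S g g <= 0.
Proof.
by have := @word_length_le [::]; rewrite big_nil /word_dist mulVg; apply.
Qed.

(** Lengths are natural numbers, so a shortest word exists and realises the infimum. Subadditivity
    and symmetry then follow by concatenating and inverting shortest words. *)
Lemma word_length_attained (g : G) : generates S ->
  exists s, [/\ is_word S s, g = (\prod_(x <- s) x)%g
    & word_length R S g = (size s)%:R].
Proof.
move=> /(word_exists g)[s0 [Ss0 g_s0]].
pose P n := `[< exists s, [/\ is_word S s, g = (\prod_(x <- s) x)%g & size s = n] >].
have exP : exists n, P n by exists (size s0); apply/asboolP; exists s0.
case: (ex_minnP exP) => _ /asboolP[s [Ss gs <-]] smin.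
exists s; split=> //; apply/le_anti/andP; split.
  by rewrite {1}gs word_length_le.
apply: lb_le_inf; first by exists (size s)%:R, s.
move=> _ [t [St gt] <-]; rewrite ler_nat; apply: smin.
by apply/asboolP; exists t.
Qed.

Hypothesis genS : generates S.

Lemma word_lengthM (g h : G) :
  word_length R S (g * h)%g <= word_length R S g + word_length R S h.
Proof.
have [s [Ss -> ->]] := word_length_attained g genS.
have [t [St -> ->]] := word_length_attained h genS.
rewrite -big_cat -natrD -size_cat.
exact/word_length_le/is_word_cat.
Qed.

Lemma word_lengthV (g : G) : word_length R S g^-1%g = word_length R S g.
Proof.
have le_inv (h : G) : word_length R S h^-1%g <= word_length R S h.
  have [s [Ss -> ->]] := word_length_attained h genS.
  rewrite -prodg_inv -(size_map (fun x => x^-1%g) s) -size_rev.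
  exact/word_length_le/is_word_inv.
by apply/le_anti; rewrite le_inv /= -{1}[g]invgK le_inv.
Qed.

Lemma word_dist_sym (g h : G) : word_dist R S g h = word_dist R S h g.
Proof. by rewrite /word_dist -word_lengthV invgM invgK. Qed.

Lemma word_dist_triangle (g h k : G) :
  word_dist R S g k <= word_dist R S g h + word_dist R S h k.
Proof.
rewrite /word_dist; apply: le_trans (word_lengthM _ _).
by rewrite -mulgA mulVKg.
Qed.

Hypothesis finS : finite_set S.

Lemma word_ball_finite (g : G) (r : R) : finite_set [set h | word_dist R S g h <= r].
Proof.
pose S' := S `|` [set x^-1%g | x in S].
have fS' : finite_set S' by rewrite finite_setU; split=> //; exact: finite_image.
(* [W n] collects the products of exactly [n] letters from [S']; the ball is covered by the
   translates [g W n] with [n < N]. *)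
pose fix W n : set G :=
  if n is m.+1 then [set (x * y)%g | x in S' & y in W m] else [set 1%g].
have fW n : finite_set (W n).
  by elim: n => [|n IHn]; [exact: finite_set1|exact: finite_image2].
have WP s : is_word S s -> W (size s) (\prod_(x <- s) x)%g.
  elim: s => [|x s IHs] Ss; first by rewrite big_nil.
  rewrite big_cons; exists x.
    have [|Sx] := Ss x (mem_head _ _); first by left.
    by right; exists x^-1%g; rewrite ?invgK.
  exists (\prod_(y <- s) y)%g => //.
  by apply: IHs => y ys; apply: Ss; rewrite inE ys orbT.
have [N rN] : exists N, r < N%:R.
  exists (Num.bound `|r|); apply: le_lt_trans (ler_norm r) _.
  exact: archi_boundP.
apply: (@finite_set_fibers _ _ _ `I_N (fun n => [set (g * x)%g | x in W n])).
- exact: finite_II.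
- by move=> n _; exact: finite_image.
move=> h /=; rewrite /word_dist.
have [s [Ss gh ->]] := word_length_attained (g^-1 * h)%g genS.
move=> sr; exists (size s); first by rewrite /= -(@ltr_nat R) (le_lt_trans sr).
by exists (g^-1 * h)%g; [rewrite gh; exact: WP|rewrite mulVKg].
Qed.

End WordMetric.

(** * Cosets, their thickenings and intersections of conjugates *)

Lemma lcoset_eq (G : groupType) (H : set G) (g b : G) :
  is_subgroup H -> lcoset g H b -> lcoset g H = lcoset b H.
Proof.
move=> sH [h Hh <-].
have HM x y : H x -> H y -> H (x * y)%g.
  by have := group_closedM sH => /(_ x y); rewrite !inE.
have HV x : H x -> H x^-1%g.
  by have := group_closedV sH => /(_ x); rewrite !inE.
apply/seteqP; split=> _ [k Hk <-].
  by exists (h^-1 * k)%g; [exact/HM/Hk/HV|rewrite -mulgA mulVKg].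
by exists (h * k)%g; [exact: HM|rewrite mulgA].
Qed.

Section CosetFamilies.
Variables (R : realType) (G : groupType) (S : set G).
Hypotheses (genS : generates S) (finS : finite_set S).
Variables (d : nat) (g : 'I_d -> G) (H : 'I_d -> set G).

(* [x = g h g^-1] moves to the point [x g = g h] of the coset [g H], at
   distance [len g]. *)
Lemma lconj_sub_thickening : exists r : R, forall i,
  \bigcap_(i in [set: 'I_d]) lconj (g i) (H i) `<=`
    thickening (word_dist R S) r (lcoset (g i) (H i)).
Proof.
have [r rP] := @finite_set_ubound R _ setT (fun i => word_length R S (g i))
  finite_finset.
exists r => i x /(_ i I)[h Hh <-]; exists (g i * h)%g; first by exists h.
by rewrite /word_dist !invgM invgK -!mulgA mulKg mulVg mulg1 rP.
Qed.

(* Points of the intersection with the same displacements [c i] to all the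
   cosets differ by an element of all the conjugates, and there are finitely
   many choices for [c]. *)
Lemma thickening_infinite_lconj (X : set G) (r : R) :
  (forall i, is_subgroup (H i)) ->
  infinite_set X ->
  (forall i, X `<=` thickening (word_dist R S) r (lcoset (g i) (H i))) ->
  infinite_set (\bigcap_(i in [set: 'I_d]) lconj (g i) (H i)).
Proof.
move=> sH infX Xr finI; apply: infX.
have /finite_seqP[s sE] := @word_ball_finite R G S genS finS 1%g r.
pose F (c : {ffun 'I_d -> seq_sub s}) : set G :=
  [set x | forall i, lcoset (g i) (H i) (x * val (c i))%g].
apply: (@finite_set_fibers _ _ X setT F); first exact: finite_finset.
  move=> c _; have [->|/set0P[y Fy]] := eqVneq (F c) set0; first exact: finite_set0.
  apply: sub_finite_set (finite_image (fun z => z * y)%g finI) => x Fx.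
  exists (x * y^-1)%g; last exact: mulgVK.
  move=> i _; have [h Hh xh] := Fx i; have [k Hk yk] := Fy i.
  exists (h * k^-1)%g.
    have HV : H i k^-1%g.
      by have := group_closedV (sH i) => /(_ k); rewrite !inE; apply.
    by have := group_closedM (sH i) => /(_ h k^-1%g); rewrite !inE; apply.
  have -> : h = ((g i)^-1 * (x * val (c i)))%g by rewrite -xh mulKg.
  have -> : k = ((g i)^-1 * (y * val (c i)))%g by rewrite -yk mulKg.
  by rewrite !invgM !invgK !mulgA mulgV mul1g !mulgK.
move=> x Xx.
have /choice[c cP] : forall i, exists b : seq_sub s,
    lcoset (g i) (H i) (x * val b)%g.
  move=> i; have [a Aa xa] := Xr i x Xx.
  have sb : (x^-1 * a)%g \in s.
    suff : [set` s] (x^-1 * a)%g by [].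
    by rewrite -sE /= /word_dist invg1 mul1g.
  by exists (SeqSub sb); rewrite /= mulVKg.
by exists [ffun i => c i] => // i; rewrite ffunE.
Qed.
End CosetFamilies.

Lemma lcoset_mul (G : groupType) (k g : G) (H : set G) (x : G) :
  lcoset g H x -> lcoset (k * g)%g H (k * x)%g.
Proof. by move=> [h Hh <-]; exists h => //; rewrite mulgA. Qed.

Lemma lcoset_refl (G : groupType) (g : G) (H : set G) :
  is_subgroup H -> lcoset g H g.
Proof. by move=> [+ _]; rewrite inE => H1; exists 1%g; rewrite ?mulg1. Qed.

(** * Transfer of finite packing along a relation *)

(** This is bounded Hausdorff distance with the bound absorbed into [E]. Transposing [E] only swaps
    the two conjuncts. *)
Definition matched (X Y : Type) (E : X -> Y -> Prop) (A : set X) (B : set Y) :=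
  (forall a, A a -> exists2 b, B b & E a b) /\
  (forall b, B b -> exists2 a, A a & E a b).

Definition bornologous (R : realType) (X Y : Type) (dX : X -> X -> R)
    (dY : Y -> Y -> R) (E : X -> Y -> Prop) :=
  forall n, exists m, forall x x' y y',
    E x y -> E x' y' -> dX x x' <= n -> dY y y' <= m.

Lemma finite_packing_transfer (R : realType) (G H : groupType)
    (P : set (set G)) (Q : set (set H)) (S : set G) (T : set H)
    (E : G -> H -> Prop) :
  group_pair P -> group_pair Q ->
  finite_set S -> generates S -> finite_set T -> generates T ->
  (forall x, exists y, E x y) -> (forall y, exists x, E x y) ->
  bornologous (word_dist R S) (word_dist R T) E ->
  bornologous (word_dist R T) (word_dist R S) (fun y x => E x y) ->
  (forall A, left_cosets P A -> exists2 B, left_cosets Q B & matched E A B) ->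
  finite_packing Q -> finite_packing P.
Proof.
move=> hP hQ finS genS finT genT totE surE upE downE PQ [D [finD DQ Dpack]].
(* All cosets in the finite set [D] meet one ball about the identity. Cosets are nonempty, so the
   default of [xget] never occurs. *)
have [rD rDP] : exists rD : R, forall B, D B ->
    exists2 b, B b & word_length R T b <= rD.
  have [r rP] := @finite_set_ubound R _ D
    (fun B => word_length R T (xget 1%g B)) finD.
  exists r => B DB; exists (xget 1%g B); last exact: rP.
  have [h [K QK ->]] := DQ _ DB.
  by apply: (@xgetPex _ 1%g); exists h; apply/lcoset_refl/(gp_subgroup hQ).
have [m mP] := downE rD.
(* The packing set for [P] consists of the cosets that meet the ball of radius [m] about the
   identity. *)
exists [set lcoset b K | b in [set b | word_dist R S 1%g b <= m] & K in P].
split.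
- by apply: finite_image2; [exact: word_ball_finite|exact: gp_finite].
- by move=> _ [b _ [K PK <-]]; exists b, K.
move=> d g K PK infK.
have /choice[B BP] : forall i, exists B : H * set H,
    Q B.2 /\ matched E (lcoset (g i) (K i)) (lcoset B.1 B.2).
  move=> i; have [|_ [h [L QL ->]] AB] := PQ (lcoset (g i) (K i)).
    by exists (g i), (K i).
  by exists (h, L).
have [r rP] := @lconj_sub_thickening R G S d g K.
have [n nP] := upE r.
(* Radius 0 bounds the fibres of [E] over a single [y]. They are therefore finite, so the image [J]
   of an infinite set stays infinite. *)
have [m0 m0P] := downE 0.
pose J := [set y | exists2 x,
  (\bigcap_(i in [set: 'I_d]) lconj (g i) (K i)) x & E x y].
have infJ : infinite_set J.
  move=> finJ; apply: infK.
  apply: (@finite_set_fibers _ _ _ J (fun y => [set x | E x y])) => //.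
    move=> y _; have [x0 Ex0] := surE y.
    apply: sub_finite_set (word_ball_finite genS finS x0 m0) => x Ex.
    exact: m0P Ex0 Ex (word_distxx_le0 _ _ _).
  by move=> x Ix; have [y Exy] := totE x; exists y => //; exists x.
have [i||k kP] := @Dpack d (fun i => (B i).1) (fun i => (B i).2).
- by have [] := BP i.
- apply: (@thickening_infinite_lconj R H T genT finT _ _ _ J n) => //.
    by move=> i; apply: (gp_subgroup hQ); have [] := BP i.
  move=> i y [x Ix Exy]; have [a Aa xa] := rP i x Ix.
  have [_ [/(_ a Aa)[b Bb Eab] _]] := BP i.
  by exists b => //; apply: nP Exy Eab xa.
(* Since [k] moves each matched coset to one that meets the [rD]-ball about the identity, each
   matched coset has a point within [rD] of [k^-1]. Pulled back along [E], every original coset has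
   a point within [m] of [x], so [x^-1] is the required translation. *)
have [x Exk] := surE k^-1%g.
exists x^-1%g => i.
have [c Bc cr] := rDP _ (kP i).
have Bkc : lcoset (B i).1 (B i).2 (k^-1 * c)%g.
  by have := lcoset_mul k^-1%g Bc; rewrite mulKg.
have [_ [_ /(_ _ Bkc)[a Aa Eac]]] := BP i.
have xa : word_dist R S x a <= m.
  by apply: mP Exk Eac _; rewrite /word_dist invgK mulVKg.
exists (x^-1 * a)%g; first by rewrite /= /word_dist invg1 mul1g.
exists (K i) => //; apply/esym/lcoset_eq; first exact: (gp_subgroup hP).
exact: lcoset_mul.
Qed.

(** * From a quasi-isometry of pairs to the relation [E] *)

Lemma hdist_lt (R : realType) (X : Type) (d : X -> X -> R) (M : R)
    (A B : set X) : (hdist d A B < M%:E)%E ->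
  A `<=` thickening d M B /\ B `<=` thickening d M A.
Proof.
(* Strictness yields an admissible radius below [M], whether or not the infimum is attained. *)
move=> /ereal_inf_lt[_ [r [_ [AB BA]] <-]]; rewrite lte_fin => /ltW rM.
by split=> x => [/AB|/BA] [y Cy xy]; exists y => //; apply: le_trans rM.
Qed.

Theorem proposition5p12 (R : realType) (G H : groupType)
    (P : set (set G)) (Q : set (set H))
    (hGP : group_pair P) (hHQ : group_pair Q)
    (S : set G) (hSfin : finite_set S) (hSgen : generates S)
    (T : set H) (hTfin : finite_set T) (hTgen : generates T) :
  quasi_isometric_pairs R S T P Q -> (finite_packing P <-> finite_packing Q).
Proof.
move=> [q [M [[K [C [K1 C0 qK qC]]] M0 PQ QP]]].
have K0 : 0 < K by apply: lt_le_trans K1.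
(* [C] makes [E] reach every point of [H]; [M] makes it match cosets. *)
pose c := C + M.
have sym := word_dist_sym R hTgen.
have tri := word_dist_triangle R hTgen.
pose E x y := word_dist R T y (q x) <= c.
have totE x : exists y, E x y.
  exists (q x); apply: le_trans (word_distxx_le0 _ _ _) _.
  by rewrite addr_ge0 // ltW.
have surE y : exists x, E x y.
  by have [x yx] := qC y; exists x; rewrite /E (le_trans yx) // lerDl ltW.
have upE : bornologous (word_dist R S) (word_dist R T) E.
  (* The path runs from [y] through [q x] and [q x'] to [y']. *)
  move=> n; exists (c + (K * n + C + c)) => x x' y y' Exy Exy' xn.
  apply: le_trans (tri _ (q x) _) _; apply: lerD => //.
  apply: le_trans (tri _ (q x') _) _; apply: lerD; last by rewrite sym.
  have [_ /le_trans] := andP (qK x x'); apply.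
  by rewrite lerD2r ler_pM2l.
have downE : bornologous (word_dist R T) (word_dist R S) (fun y x => E x y).
  (* Here [q x] and [q x'] are at most [c + (n + c)] apart, via [y] and [y']; the lower
     quasi-isometry bound is solved for the distance from [x] to [x']. *)
  move=> n; exists (K * (c + (n + c) + C)) => y y' x x' Exy Exy' yn.
  rewrite -ler_pdivrMl // -lerBlDr.
  have [/le_trans + _] := andP (qK x x'); apply.
  apply: le_trans (tri _ y _) _; apply: lerD; first by rewrite sym.
  by apply: le_trans (tri _ y' _) _; apply: lerD.
have Mc : M <= c by rewrite lerDr.
have matchE A B : (hdist (word_dist R T) (q @` A) B < M%:E)%E -> matched E A B.
  move=> /hdist_lt[AB BA]; split=> [a Aa|b Bb].
    have [|b Bb ab] := AB (q a); first by exists a.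
    by exists b => //; rewrite /E sym (le_trans ab).
  have [_ [a Aa <-] ba] := BA b Bb.
  by exists a => //; apply: le_trans ba Mc.
split.
(* Packing passes from [P] to [Q] by using the transposed relation, which exchanges [totE] with
   [surE] and [upE] with [downE]. *)
- apply: (finite_packing_transfer hHQ hGP hTfin hTgen hSfin hSgen
    surE totE downE upE) => B /QP[A PA AB].
  by exists A => //; have [] := matchE _ _ AB.
- apply: (finite_packing_transfer hGP hHQ hSfin hSgen hTfin hTgen
    totE surE upE downE) => A /PQ[B QB AB].
  by exists B => //; exact: matchE.
Qed.
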